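(* Let $m$ and $n$ be natural numbers and let $D$ be an $m\times n$ diagram. Then $\det(M(D))$ is either $0$ or a power of $4$ (that is, $4^k$ for some integer $k\ge 0$).
   Context: An $m\times n$ diagram is an $m\times n$ grid of $mn$ squares in which each square is colored either black or white. If $D$ has $N$ white squares, label the white squares $1,\dots,N$ so that labels increase strictly from left to right along each row and every white square in a higher row has a smaller label than every white square in a lower row. The skew-adjacency matrix $M(D)$ is the $N\times N$ integer matrix whose $(i,j)$ entry is: (1) $1$ if the square labelled $i$ is strictly to the left of and in the same row as the square labelled $j$, or is strictly above and in the same column as the square labelled $j$; (2) $-1$ if the square labelled $i$ is strictly to the right of and in the same row as the square labelled $j$, or is strictly below and in the same column as the square labelled $j$; (3) $0$ otherwise. The determinant of the $0\times 0$ matrix (no white squares) is $1$. *)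

(* Defs.v *)
From mathcomp Require Import all_boot all_order all_algebra.

Set Implicit Arguments.
Unset Strict Implicit.
Unset Printing Implicit Defensive.

Import Order.TTheory GRing.Theory Num.Theory.
Local Open Scope ring_scope.

(* A square is a pair (row, column), row 0 being the top row and column 0 the
   leftmost one; a diagram is given by its set of white squares. *)
Definition diagram (m n : nat) : Type := {set 'I_m * 'I_n}.

Definition left_of (m n : nat) (s t : 'I_m * 'I_n) : bool :=
  (s.1 == t.1) && (s.2 < t.2)%N.

Definition above (m n : nat) (s t : 'I_m * 'I_n) : bool :=
  (s.2 == t.2) && (s.1 < t.1)%N.

(* [enum] lists a product of ordinals in row-major order, so [enum_val] is the
   required labelling of the white squares, with labels starting at 0; see
   [white_square_mono]. *)
Definition white_square (m n : nat) (D : diagram m n) (i : 'I_#|D|) :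
  'I_m * 'I_n := enum_val i.

Definition skew_adjacency (m n : nat) (D : diagram m n) : 'M[int]_#|D| :=
  \matrix_(i, j)
    let s := white_square i in
    let t := white_square j in
    if left_of s t || above s t then 1
    else if left_of t s || above t s then -1
    else 0.

Lemma white_square_mono (m n : nat) (D : diagram m n) (i j : 'I_#|D|) :
  (i < j)%N =
  ((white_square i).1 < (white_square j).1)%N
  || left_of (white_square i) (white_square j).
Proof.
pose r (s t : 'I_m * 'I_n) := (s.1 < t.1)%N || left_of s t.
have r_irr : irreflexive r by move=> s; rewrite /r /left_of !ltnn andbF.
have r_tr : transitive r.
  move=> [t1 t2] [s1 s2] [u1 u2]; rewrite /r /left_of /=.
  case/orP=> [h1|/andP[/eqP-> h1]] /orP[h2|/andP[/eqP<- h2]].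
  - by rewrite (ltn_trans h1 h2).
  - by rewrite h1.
  - by rewrite h2.
  - by rewrite eqxx (ltn_trans h1 h2) orbT.
have srt : sorted r (enum D).
  have prodE : Finite.enum ('I_m * 'I_n)%type = prod_enum 'I_m 'I_n.
    by rewrite {1}Finite.enum.unlock.
  have -> : enum D = filter [in D] (prod_enum 'I_m 'I_n) by rewrite -prodE.
  rewrite sorted_filter // sorted_pairwise // /prod_enum.
  have ltn_enum k : pairwise (fun a b : 'I_k => a < b)%N (enum 'I_k).
    rewrite -(pairwise_map val ltn) val_enum_ord -sorted_pairwise.
      exact: iota_ltn_sorted.
    exact: ltn_trans.
  elim: (enum 'I_m) (ltn_enum m) => //= a l IHl /andP[al /IHl lP].
  rewrite pairwise_cat lP andbT; apply/andP; split.
    apply/allrelP => _ _ /mapP[b _ ->] /allpairsP[[c d] /= [cl _ ->]].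
    by rewrite /r /= (allP al).
  rewrite pairwise_map; apply: sub_pairwise (ltn_enum n) => b c bc.
  by rewrite /= /r /left_of /= eqxx bc orbT.
have mono (a b : 'I_#|D|) : (a < b)%N -> r (white_square a) (white_square b).
  move=> ab; rewrite /white_square.
  pose x0 := white_square a.
  rewrite (enum_val_nth x0 a) (enum_val_nth x0 b).
  by apply: (sorted_ltn_nth r_tr) => //; rewrite inE -cardE.
apply/idP/idP; first exact: mono.
move=> rij; rewrite ltnNge; apply/negP.
rewrite leq_eqVlt => /orP[/eqP/val_inj e|/mono h].
  by move: rij; rewrite e -/(r _ _) r_irr.
by have := r_tr _ _ _ h rij; rewrite r_irr.
Qed.

(* Main.v *)
(** Let [V] be the unitriangular matrix with entry 1 at [(i, j)] when [i = j]
    or square [i] is left of or above square [j], and let [W] be the incidence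
    matrix of white squares against rows and columns. Then [M(D) = V - V^T] and
    [V + V^T = W W^T], so that [Q = 1 - W^T V^-1 W] is an integer orthogonal
    matrix, and Sylvester's identity turns [det M(D)] into [det (1 + Q)] up to
    a power of 2. Eliminating one coordinate at a time, [det (1 + Q)] is 0 or a
    power of 2. As [M(D)] is skew-symmetric, its determinant is a square, which
    makes the exponent even. *)
Require Import Defs.
From mathcomp Require Import all_boot all_order all_algebra.
From mathcomp Require Import perm zify.

Import Order.TTheory GRing.Theory Num.Theory.
Local Open Scope ring_scope.

(** Schur complement formula: a block column operation of determinant 1 clears [B]. *)
Lemma det_schur (R : comUnitRingType) (p n : nat) (P : 'M[R]_p)
    (B : 'M_(p, n)) (C : 'M_(n, p)) (D : 'M_n) :
  P \in unitmx ->
  \det (block_mx P B C D) = \det P * \det (D - C *m invmx P *m B).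
Proof.
move=> uP; have -> : \det (block_mx P B C D) =
    \det (block_mx P B C D *m block_mx 1%:M (- (invmx P *m B)) 0 1%:M).
  by rewrite det_mulmx det_ublock !det1 !mulr1.
rewrite mulmx_block !mulmx1 !mulmx0 !addr0 !mulmxN mulmxA mulmxV // mul1mx.
by rewrite addNr mulmxA det_lblock addrC.
Qed.

(** Induction removing two coordinates at a time. Unless row 0 vanishes, conjugating by a
    transposition brings a nonzero entry [a] to position (0, 1). The leading 2 by 2 block then has
    determinant [a ^+ 2], and its Schur complement is again skew-symmetric. *)
Lemma det_skew_square (F : numFieldType) (n : nat) (A : 'M[F]_n) :
  A^T = - A -> exists d, \det A = d ^+ 2.
Proof.
have [k] := ubnP n; elim: k n A => // k IHk n A ltnk skA.
have Aij i j : A i j = - A j i.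
  by have /matrixP/(_ j i) := skA; rewrite !mxE.
have Aii i : A i i = 0.
  have : A i i + A i i == 0 by rewrite addr_eq0 -Aij.
  by rewrite -mulr2n mulrn_eq0 => /eqP.
case: n A ltnk skA Aij Aii => [|[|n]] A ltnk skA Aij Aii.
- by exists 1; rewrite det_mx00 expr1n.
- by exists 0; rewrite det_mx11 Aii expr0n.
have [/existsP[j Aj]|/existsPn A0] := boolP [exists j, A 0 j != 0]; last first.
  exists 0; rewrite expr0n (expand_det_row A 0) big1 // => j _.
  by have := A0 j; rewrite negbK => /eqP->; rewrite mul0r.
pose i1 : 'I_n.+2 := lift 0 (0 : 'I_n.+1).
have j0 : j != 0 by apply: contraNneq Aj => ->; rewrite Aii.
pose T := tperm_mx j i1 : 'M[F]_n.+2.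
pose A' : 'M_(2 + n) := T *m A *m T.
have detA : \det A' = \det A.
  rewrite !det_mulmx mulrAC -det_mulmx.
  have -> : T *m T = 1%:M by rewrite -perm_mxM tperm2 perm_mx1.
  by rewrite det1 mul1r.
have A'ij i k' : A' i k' = A (tperm j i1 i) (tperm j i1 k').
  by rewrite /A' /T -xrowE -xcolE !mxE.
have skA' i k' : A' i k' = - A' k' i by rewrite !A'ij.
have A'0 i : A' i i = 0 by rewrite A'ij.
have A'01 : A' 0 i1 != 0 by rewrite A'ij tpermR tpermD // eq_sym.
clearbody A'; rewrite -{}detA.
pose P := ulsubmx A'; pose B := ursubmx A'; pose D := drsubmx A'.
have blk : A' = block_mx P B (- B^T) D.
  rewrite -[LHS]submxK; congr block_mx.
  by apply/matrixP => a b; rewrite !mxE skA'.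
have PT : P^T = - P by apply/matrixP => a b; rewrite !mxE skA'.
have DT : D^T = - D by apply/matrixP => a b; rewrite !mxE skA'.
have detP : \det P = (A' 0 i1) ^+ 2.
  rewrite (expand_det_row P 0) !big_ord_recl big_ord0 /cofactor !det_mx11 !mxE.
  have -> : lshift n (0 : 'I_2) = 0 by apply: val_inj.
  have -> : lshift n (lift 0 (0 : 'I_1) : 'I_2) = i1 by apply: val_inj.
  have -> : lshift n (lift (lift ord0 ord0 : 'I_2) (0 : 'I_1)) = 0.
    by apply: val_inj.
  by rewrite A'0 mul0r add0r addr0 expr1 mulN1r (skA' i1) opprK expr2.
have uP : P \in unitmx by rewrite unitmxE detP unitfE expf_neq0.
have [|d dE] := IHk n (D - (- B^T) *m invmx P *m B) (ltac:(lia)).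
  rewrite linearB /= !trmx_mul trmx_inv PT DT linearN /= trmxK.
  have -> : invmx (- P) = - invmx P.
    by rewrite -!scaleN1r invmxZ ?invrN1 ?unitmxZ ?unitrN1.
  by rewrite !mulNmx !mulmxN !opprK opprD mulmxA.
by exists (A' 0 i1 * d); rewrite [in LHS]blk det_schur // detP dE exprMn.
Qed.

Lemma det_add1_orthogonal (n : nat) (Q : 'M[int]_n) :
  Q *m Q^T = 1%:M -> \det (1%:M + Q) = 0 \/ exists k, \det (1%:M + Q) = 2 ^+ k.
Proof.
elim: n Q => [|n IHn] Q; first by right; exists 0%N; rewrite det_mx00.
rewrite -[n.+1]/(1 + n)%N in Q *.
set q := ulsubmx Q; set r := ursubmx Q; set c := dlsubmx Q; set Q' := drsubmx Q.
rewrite -(submxK Q) -/q -/r -/c -/Q' tr_block_mx mulmx_block.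
rewrite (scalar_mx_block 1 n 1) add_block_mx !add0r.
clearbody q r c Q'.
move=> /eq_block_mx[qr rc _ cQ].
(* If [q = 0], eliminating the corner 1 of [1 + Q] leaves [1 + (Q' - c r)]. Here [Q' - c r] is still
   orthogonal, because [r] is a unit row orthogonal to the rows of [Q']. *)
have [q0|q0] := eqVneq q 0.
  rewrite q0 !mul0mx !add0r in qr rc.
  rewrite q0 addr0 det_schur ?unitmx1 // det1 mul1r invmx1 mulmx1 -addrA.
  apply: IHn; rewrite linearB /= trmx_mul mulmxBr !mulmxBl !mulmxA.
  have rQ : Q' *m r^T = 0 by rewrite -[LHS]trmxK trmx_mul trmxK rc trmx0.
  by rewrite rQ mul0mx sub0r opprK -!(mulmxA c r) rc qr mulmx0 mulmx1 subr0 addrC.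
(* An integer row of norm 1 with [q] nonzero has [q] equal to 1 or -1 and zeros elsewhere. Then [c]
   vanishes too, and the corner contributes a factor 2 or 0. *)
have qr00 : q 0 0 ^+ 2 + \sum_j r 0 j ^+ 2 = 1.
  have /matrixP/(_ 0 0) := qr; rewrite !mxE big_ord1 !mxE eqxx mulr1n => <-.
  by congr (_ + _); apply: eq_bigr => j _; rewrite !mxE.
have r2_ge0 : 0 <= \sum_j r 0 j ^+ 2 by apply: sumr_ge0 => j _; apply: sqr_ge0.
have q00 : q 0 0 != 0.
  by apply: contraNneq q0 => q00; apply/eqP/matrixP => i j; rewrite !ord1 [RHS]mxE.
have q1 : q 0 0 ^+ 2 = 1.
  have : 0 < q 0 0 ^+ 2 by rewrite exprn_even_gt0.
  lia.
have r0 : r = 0.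
  have /eqP : \sum_j r 0 j ^+ 2 = 0 by lia.
  rewrite psumr_eq0 => [/allP rj|j _]; last exact: sqr_ge0.
  apply/matrixP => i j; rewrite ord1 [RHS]mxE; apply/eqP.
  by rewrite -sqrf_eq0 (implyP (rj j _)) // mem_index_enum.
have c0 : c = 0.
  rewrite r0 mul0mx addr0 in rc; apply/matrixP => i j.
  have /matrixP/(_ 0 i)/eqP := rc; rewrite !mxE big_ord1 !mxE mulf_eq0.
  by rewrite (negPf q00) /= (ord1 j) => /eqP.
have [|Q'0|[k Q'k]] := IHn Q'; first by rewrite -cQ c0 mul0mx add0r.
  by left; rewrite r0 det_lblock Q'0 mulr0.
rewrite r0 det_lblock det_mx11 Q'k !mxE.
move/eqP: q1; rewrite sqrf_eq1 => /orP[] /eqP->.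
  by right; exists k.+1; rewrite exprS.
by left; rewrite addrN mul0r.
Qed.

Lemma det_sub_tr_power4 (N p : nat) (V : 'M[int]_N) (W : 'M[int]_(N, p)) :
  \det V = 1 -> V + V^T = W *m W^T ->
  \det (V - V^T) = 0 \/ exists k, \det (V - V^T) = 4 ^+ k.
Proof.
move=> detV VW; have uV : V \in unitmx by rewrite unitmxE detV unitr1.
have VTE : V^T = W *m W^T - V by rewrite -VW addrC addKr.
pose X := invmx V; pose Q : 'M_p := 1%:M - W^T *m X *m W.
have orthQ : Q *m Q^T = 1%:M.
  have XX : X *m (W *m W^T) *m X^T = X^T + X.
    rewrite -VW mulmxDr mulmxDl mulVmx // mul1mx -mulmxA -trmx_mul mulVmx //.
    by rewrite trmx1 mulmx1.
  rewrite /Q linearB /= trmx1 !trmx_mul trmxK mulmxBl mul1mx mulmxBr mulmx1.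
  have -> : W^T *m X *m W *m (W^T *m (X^T *m W)) =
      W^T *m (X *m (W *m W^T) *m X^T) *m W by rewrite !mulmxA.
  rewrite XX mulmxDr mulmxDl !mulmxA.
  by rewrite opprB addrK subrK.
(* Two evaluations of one block determinant: the Schur complement of [V] is [2 - W^T X W = 1 + Q],
   while right multiplication by the block matrix with rows [(2, 0)] and [(- W^T, 1)] yields the
   upper triangular one with diagonal [V - V^T], [2]. *)
have sylv : \det (V - V^T) * 2 ^+ p = 2 ^+ N * \det (1%:M + Q).
  have <- : \det (block_mx V W W^T (2%:M : 'M_p)) = \det (1%:M + Q).
    rewrite det_schur // detV mul1r /Q addrA; congr (\det (_ - _)).
    by rewrite -raddfD.
  rewrite -[2 ^+ N]det_scalar mulrC.
  have -> : \det (2%:M : 'M[int]_N) =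
     \det (block_mx (2%:M : 'M[int]_N) 0 (- W^T) (1%:M : 'M_p)).
    by rewrite det_lblock det1 mulr1.
  rewrite mulrC -[RHS]mulrC -det_mulmx mulmx_block.
  rewrite !mul_scalar_mx !mul_mx_scalar mulmxN scalerN addrN.
  rewrite !mulmx0 !add0r det_ublock scalemx1 det_scalar; congr (\det _ * _).
  by rewrite VTE opprB scaler_nat mulr2n addrA.
have [d dE] : exists d : rat, \det (map_mx intr (V - V^T)) = d ^+ 2.
  apply: det_skew_square.
  by rewrite map_trmx linearB /= trmxK -map_mxN opprB.
rewrite det_map_mx in dE; move: (\det (V - V^T)) sylv dE => a sylv dE.
have {}dE : a%:~R = d ^+ 2 by [].
have [a0|aN0] := eqVneq a 0; [by left | right].
have [Q0|[k Qk]] := det_add1_orthogonal p Q orthQ.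
  move/eqP: sylv; rewrite Q0 mulr0 mulf_eq0 (negPf aN0) expf_eq0 /=.
  by rewrite andbF.
have a_ge0 : 0 <= a by rewrite -(ler0z rat) dE sqr_ge0.
have dn : a * denq d ^+ 2 = numq d ^+ 2.
  apply: (intr_inj (R := rat)); rewrite rmorphM !rmorphXn /= dE.
  by rewrite -exprMn numqE mulrC.
case: a a_ge0 aN0 dn sylv {dE} => // a _ aN0 dn sylv.
(* By [sylv], [a] divides [2 ^ (N + k)]. *)
have [c _ ac] : exists2 c, (c <= N + k)%N & a = (2 ^ c)%N.
  apply/dvdn_pfactor => //; apply/dvdnP; exists (2 ^ p)%N.
  have := congr1 absz sylv; rewrite Qk !abszM !abszX /= => ap.
  by rewrite expnD -ap mulnC.
have dN0 : (0 < `|numq d|)%N.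
  rewrite absz_gt0; apply: contraNneq aN0 => d0.
  move/eqP: dn; rewrite d0 expr0n mulf_eq0 expf_eq0 /= denq_eq0.
  by rewrite orbF.
have : (a * `|denq d| ^ 2 = `|numq d| ^ 2)%N.
  by have := congr1 absz dn; rewrite abszM !abszX.
have den_gt0 : (0 < `|denq d|)%N by rewrite absz_gt0 denq_eq0.
(* Comparing 2-adic valuations shows that [c] is even; it also shows that the truncated subtraction
   in the witness below is exact. *)
move/(congr1 (logn 2)); rewrite {1}ac lognM ?expn_gt0 ?den_gt0 //.
rewrite !lognX logn_prime // eqxx muln1 => cE.
exists (logn 2 `|numq d| - logn 2 `|denq d|)%N.
have {}cE : c = (2 * (logn 2 `|numq d| - logn 2 `|denq d|))%N by lia.
by rewrite ac {1}cE expnM -natz natrX.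
Qed.

Theorem theorem2p2 (m n : nat) (D : diagram m n) :
  \det (skew_adjacency D) = 0 \/
  exists k : nat, \det (skew_adjacency D) = 4 ^+ k.
Proof.
pose V : 'M[int]_#|D| := \matrix_(i, j)
  ((i == j) || left_of (white_square i) (white_square j) ||
    above (white_square i) (white_square j))%:R.
pose W : 'M[int]_(#|D|, m + n) := row_mx
  (\matrix_(i, k) ((white_square i).1 == k)%:R)
  (\matrix_(i, k) ((white_square i).2 == k)%:R).
have sum_eq (l : nat) (x y : 'I_l) :
    \sum_k (x == k)%:R * (y == k)%:R = (x == y)%:R :> int.
  rewrite (bigD1 x) //= eqxx mul1r big1 ?addr0 1?eq_sym // => k /negPf.
  by rewrite eq_sym => ->; rewrite mul0r.
have eq_white (i j : 'I_#|D|) : (i == j) =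
    ((white_square i).1 == (white_square j).1) &&
    ((white_square i).2 == (white_square j).2).
  by rewrite -xpair_eqE -!surjective_pairing (inj_eq enum_val_inj).
have -> : skew_adjacency D = V - V^T.
  apply/matrixP => i j; rewrite !mxE (eq_sym j i) eq_white /left_of /above.
  move: (white_square i) (white_square j) => [a b] [a' b'] /=.
  rewrite -!val_eqE /=.
  by case: (ltngtP a a') => ?; case: (ltngtP b b').
apply: (@det_sub_tr_power4 _ _ V W).
  (* Labels increase in row-major order, so a square left of or above another has the smaller label:
     [V^T] is lower triangular with unit diagonal. *)
  rewrite -det_tr det_trig.
    by rewrite big1 // => i _; rewrite !mxE eqxx.
  apply/is_trig_mxP => i j ltij; rewrite !mxE.
  have : ~~ (j < i)%N by rewrite -leqNgt ltnW.
  rewrite white_square_mono negb_or => /andP[h1 /negPf->].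
  have /negPf-> : j != i by rewrite -val_eqE /= gtn_eqF.
  by rewrite /above (negPf h1) andbF.
(* An entry of [W *m W^T] counts the lines shared by two squares: 2 for equal squares, 1 for
   distinct squares in a common row or column, else 0. *)
rewrite tr_row_mx mul_row_col; apply/matrixP => i j; rewrite !mxE.
under eq_bigr => k _ do rewrite !mxE.
under [X in _ = _ + X]eq_bigr => k _ do rewrite !mxE.
rewrite !sum_eq (eq_sym j i) eq_white /left_of /above.
move: (white_square i) (white_square j) => [a b] [a' b'] /=.
rewrite -!val_eqE /=.
by case: (ltngtP a a') => ?; case: (ltngtP b b').
Qed.
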